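(* Let $k\ge2$, let $\mathcal H_1,\dots,\mathcal H_{k+1}$ be Hilbert spaces, let $A_i\in B(\mathcal H_i,\mathcal H_{i+1})$ $(i=1,\dots,k)$ be contractions, and let $A=A_k\cdots A_1$. The following conditions are equivalent: (i) $A=A_k\cdots A_1$ is a $k$-regular factorization. (ii) $\overline{\{D_{A_{j+1}}h\oplus D_{A_1^*\cdots A_j^*}h:h\in\mathcal H_{j+1}\}}=\mathcal D_{A_{j+1}}\oplus\mathcal D_{A_1^*\cdots A_j^*}$ for $j=1,\dots,k-1$. (iii) $D_{A_{j+1}}\mathcal H_{j+1}\cap D_{A_1^*\cdots A_j^*}\mathcal H_{j+1}=\{0\}$ for $j=1,\dots,k-1$.
   Context: All Hilbert spaces are complex and separable. For a contraction $B\in B(\mathcal H,\mathcal K)$, $D_B=(I-B^*B)^{1/2}\in B(\mathcal H)$ and $\mathcal D_B=\overline{D_B\mathcal H}$. In particular $D_{A_1^*\cdots A_j^*}$ is the defect operator of the contraction $A_1^*\cdots A_j^*=(A_j\cdots A_1)^*:\mathcal H_{j+1}\to\mathcal H_1$. For a factorization $A=A_k\cdots A_1$ into contractions $A_i\in B(\mathcal H_i,\mathcal H_{i+1})$ there is a well-defined isometry $Z_k:\mathcal D_A\to\mathcal D_{A_k}\oplus\cdots\oplus\mathcal D_{A_1}$ determined by $Z_k(D_Ah)=D_{A_k}A_{k-1}\cdots A_1h\oplus D_{A_{k-1}}A_{k-2}\cdots A_1h\oplus\cdots\oplus D_{A_1}h$, $h\in\mathcal H_1$. The factorization is $k$-regular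 if $Z_k$ is unitary. *)

(* Defs.v *)
From HB Require Import structures.
From mathcomp Require Import all_boot all_order all_algebra.
From mathcomp Require Export complex.
From mathcomp Require Import all_classical all_reals all_analysis.

Set Implicit Arguments.
Unset Strict Implicit.
Unset Printing Implicit Defensive.

Import Order.TTheory GRing.Theory Num.Theory.
Import numFieldNormedType.Exports.

Local Open Scope classical_set_scope.
Local Open Scope ring_scope.

(* [inner] is linear in its first argument and conjugate-linear in its
   second. The norm takes its (real, nonnegative) values in R[i]. *)
HB.mixin Record NormedModule_isHilbert (R : realType) (H : Type)
    of NormedModule R[i] H := {
  inner : {dot H for @Num.conj R[i]};
  inner_normE : forall x : H, inner x x = `|x| ^+ 2 }.

#[short(type="hilbertType")]
HB.structure Definition Hilbert (R : realType) :=
  {H of CompleteNormedModule R[i] H & NormedModule_isHilbert R H}.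

Notation "''[' u , v ]" := (inner u v) : ring_scope.

Definition separable (T : topologicalType) : Prop :=
  exists2 S : set T, countable S & dense S.

Section Operators.
Variable R : realType.
Implicit Types H K : hilbertType R.

Definition contractive H K (B : H -> K) : Prop := forall x, `|B x| <= `|x|.

(* The adjoint is the unique S with the property below; for bounded linear B
   it exists, and is bounded linear, by the Riesz representation theorem. *)
Definition adj H K (B : H -> K) : K -> H :=
  xget (fun=> 0) [set S | forall x y, '[B x, y] = '[x, S y]].

(* Since 0 <= z in R[i] entails that z is real, positivity includes
   self-adjointness. *)
Definition positive_op H (S : H -> H) : Prop :=
  [/\ linear S, continuous S & forall x, 0 <= '[S x, x]].

(* The positive square root T^(1/2), unique and existing for every positive
   operator T. *)
Definition op_sqrt H (T : H -> H) : H -> H :=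
  xget (fun=> 0) [set S | positive_op S /\ S \o S = T].

(* D_B = (I - B^* B)^(1/2) *)
Definition defect H K (B : H -> K) : H -> H :=
  op_sqrt (fun h => h - adj B (B h)).

Definition defect_space H K (B : H -> K) : set H :=
  closure (range (defect B)).

End Operators.

(* Indices start at 0: H i and A i are the textbook H_(i+1) and A_(i+1), so
   that [chain A j] is A_j ... A_1 : H_1 -> H_(j+1). Families are indexed by
   nat; for a factorization into k factors only A i with i < k and H i with
   i <= k matter. *)
Fixpoint chain (R : realType) (H : nat -> hilbertType R)
    (A : forall i, {linear H i -> H i.+1}) (j : nat) : H 0%N -> H j :=
  if j is j'.+1 then A j' \o chain A j' else id.

Section Regular.
Variables (R : realType) (H : nat -> hilbertType R).
Variables (A : forall i, {linear H i -> H i.+1}) (k : nat).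

(* A vector of the Hilbert direct sum of the H i, i < k, is a dependent
   function x, with squared norm \sum_i `|x i| ^+ 2. *)
Definition defect_sum : set (forall i : 'I_k, H i) :=
  [set x | forall i : 'I_k, defect_space (A i) (x i)].

(* Only the values of Z on the defect space of A_k ... A_1 matter. They are
   determined by these conditions, Z being isometric, hence continuous. *)
Definition is_Z (Z : H 0%N -> forall i : 'I_k, H i) : Prop :=
  let D := defect_space (chain A k) in
  [/\ forall (a : R[i]) (x y : H 0%N), D x -> D y ->
        forall i, Z (a *: x + y) i = a *: Z x i + Z y i,
      forall x, D x -> \sum_(i < k) `|Z x i| ^+ 2 = `|x| ^+ 2,
      Z @` D `<=` defect_sum
    & forall h (i : 'I_k),
        Z (defect (chain A k) h) i = defect (A i) (chain A i h)].

Definition k_regular : Prop :=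
  exists2 Z, is_Z Z & Z @` defect_space (chain A k) = defect_sum.

End Regular.

(* Main.v *)
Require Import Defs.
From HB Require Import structures.
From mathcomp Require Import all_boot all_order all_algebra complex.
From mathcomp Require Import all_classical all_reals all_analysis.
From mathcomp Require Import ring lra.
Import Order.TTheory GRing.Theory Num.Theory.
Import numFieldNormedType.Exports.
Local Open Scope classical_set_scope.
Local Open Scope ring_scope.
Set Implicit Arguments.
Unset Strict Implicit.
Unset Printing Implicit Defensive.

(** Write C_j = A_j ... A_1 and, for h in H_1, let [row h] be the family of the
    vectors D_(A_i) C_(i-1) h, so that Z_k is the isometry sending D_(C_k) h to
    [row h].  Three observations prove the theorem.

    First, the range of Z_k is the closure of the set of all rows, so regularity
    says that no nonzero x in the sum of the defect spaces is orthogonal to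
    every row ([regular_row_total], [row_total_regular]).  This totality
    condition is compared for k and k + 1 ([row_totalS]).  Since Z_k is
    isometric, the functionals h |-> <x, row h> given by families x of length k
    are exactly the functionals h |-> <D_(C_k) y, h>.  A family of length k + 1
    with last entry x' is therefore orthogonal to all rows if and only if
      C_k^* D_(A_(k+1)) x' = D_(C_k) y
    for the vector y that represents minus its first k entries.

    Second, C^* u lies in the range of D_C if and only if u lies in the range of
    D_(C^* ) ([adj_defect_range]).  Both directions come from the intertwining
    relation C D_C = D_(C^* ) C, and one of them also from
    u = C C^* u + D_(C^* )^2 u.  Hence passing from k to k + 1 adds exactly the
    condition that the ranges of D_(A_(k+1)) and D_(C_k^* ) meet trivially, which
    gives the equivalence of (i) and (iii) by induction.

    Third, for any two symmetric contractions D1 and D2 the pairs (D1 h, D2 h)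
    are dense in the product of the closures of the two ranges if and only if
    these ranges meet trivially ([dense_pairP], [joint_kernelP]): a vector (x, y)
    is orthogonal to all the pairs when D1 x = - D2 y, and each D is injective on
    the closure of its range.  This gives the equivalence of (ii) and (iii).

    The operators involved have to be constructed.  Adjoints come from the Riesz
    representation theorem [riesz], and the square root of 1 - X is 1 - Y, where
    Y is the limit of Y_(n+1) = (X + Y_n^2) / 2.  As each Y_n is a polynomial in
    X, the intertwining relation passes to the limit.  Both Riesz and the density
    arguments rest on one projection lemma, [fam_closure_proj].

    Everything is computed with the real part of the inner product: identities
    between complex linear operators follow from those for the real part
    ([inner_rip]), and real quantities can be compared linearly. *)

Local Notation toC a := ((real_complex _) a).

(** * The real inner product *)

Section RealInner.
Variables (R : realType).
Local Notation C := (R[i]).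

Section One.
Variable (H : hilbertType R).
Implicit Types x y z : H.

(** The inner product of the underlying real Hilbert space, and its squared
    norm.  Squared norms keep all estimates polynomial. *)
Definition rip x y : R := complex.Re '[x, y].
Definition sqn x : R := rip x x.

Lemma ripDl x y z : rip (x + y) z = rip x z + rip y z.
Proof. by rewrite /rip linearDl raddfD. Qed.
Lemma ripBl x y z : rip (x - y) z = rip x z - rip y z.
Proof. by rewrite /rip linearBl raddfB. Qed.
Lemma rip_sym x y : rip x y = rip y x.
Proof. by rewrite /rip hermC/= expr0 mul1r; case: '[y, x]. Qed.
Lemma ripZl (a : R) x y : rip (toC a *: x) y = a * rip x y.
Proof.
by rewrite /rip linearZl_LR /=; case: '[x, y] => u v /=; rewrite mul0r subr0.
Qed.
Lemma ripil x y : rip ('i%C *: x) y = - complex.Im '[x, y].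
Proof.
by rewrite /rip linearZl_LR /=; case: '[x, y] => u v /=; rewrite mul0r mul1r sub0r.
Qed.
Lemma sqn_norm x : (`|x| ^+ 2 : C) = toC (sqn x).
Proof.
rewrite -inner_normE /sqn /rip.
have : '[x, x] \is Num.real by rewrite ger0_real// dnorm_ge0.
by case: '[x, x] => a b; rewrite complex_real => /eqP ->.
Qed.

Lemma ripNl x y : rip (- x) y = - rip x y.
Proof. by rewrite /rip linearNl raddfN. Qed.
Lemma rip0l y : rip 0 y = 0.
Proof. by rewrite /rip linear0l. Qed.
Lemma ripDr x y z : rip x (y + z) = rip x y + rip x z.
Proof. by rewrite !(rip_sym x) ripDl. Qed.
Lemma ripBr x y z : rip x (y - z) = rip x y - rip x z.
Proof. by rewrite !(rip_sym x) ripBl. Qed.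
Lemma ripNr x y : rip x (- y) = - rip x y.
Proof. by rewrite !(rip_sym x) ripNl. Qed.
Lemma rip0r x : rip x 0 = 0.
Proof. by rewrite rip_sym rip0l. Qed.
Lemma ripZr (a : R) x y : rip x (toC a *: y) = a * rip x y.
Proof. by rewrite !(rip_sym x) ripZl. Qed.
Lemma ripii x y : rip ('i%C *: x) ('i%C *: y) = rip x y.
Proof.
rewrite /rip linearZl_LR linearZr_LR/= mulrA.
by case: '[x, y] => u v /=; lra.
Qed.

(** The complex inner product is determined by its real part; this is how
    identities proved for [rip] are carried back to the complex one. *)
Lemma inner_rip x y : '[x, y] = (rip x y +i* - rip ('i%C *: x) y)%C.
Proof. by rewrite ripil opprK /rip; case: '[x, y]. Qed.

Lemma sqn_ge0 x : 0 <= sqn x.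
Proof. by have := exprn_ge0 2 (normr_ge0 x); rewrite sqn_norm lecR. Qed.
Lemma sqn0 : sqn (0 : H) = 0. Proof. exact: rip0l. Qed.
Lemma sqn_eq0 x : sqn x = 0 -> x = 0.
Proof.
move=> x0; have := sqn_norm x; rewrite x0 => /eqP.
by rewrite expf_eq0/= normr_eq0 => /eqP.
Qed.
Lemma sqnD x y : sqn (x + y) = sqn x + 2 * rip x y + sqn y.
Proof. by rewrite /sqn ripDl !ripDr (rip_sym y x); ring. Qed.
Lemma sqnN x : sqn (- x) = sqn x.
Proof. by rewrite /sqn ripNl ripNr opprK. Qed.
Lemma sqnB x y : sqn (x - y) = sqn x - 2 * rip x y + sqn y.
Proof. by rewrite sqnD ripNr sqnN; ring. Qed.
Lemma sqn_dist x y : sqn (x - y) = sqn (y - x).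
Proof. by rewrite -sqnN opprB. Qed.
Lemma sqnZ (a : R) x : sqn (toC a *: x) = a ^+ 2 * sqn x.
Proof. by rewrite /sqn ripZl ripZr mulrA. Qed.
Lemma sqnZC (a : C) x : sqn (a *: x) = complex.Re (`|a| ^+ 2 : C) * sqn x.
Proof.
rewrite /sqn /rip dnormZ; have : (`|a| ^+ 2 : C) \is Num.real.
  by apply/ger0_real/exprn_ge0.
by move=> /complex_realP [r ->]; case: '[x, x] => u v /=; rewrite mul0r subr0.
Qed.

Lemma sqn_par x y : sqn (x + y) + sqn (x - y) = 2 * sqn x + 2 * sqn y.
Proof. by rewrite sqnB sqnD; ring. Qed.

Lemma sqn_triangle x y z : sqn (x - z) <= 2 * sqn (x - y) + 2 * sqn (y - z).
Proof.
have := sqn_par (x - y) (y - z); rewrite addrA subrK => <-.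
by rewrite lerDl sqn_ge0.
Qed.

Lemma sqn_lt_norm x (e : R) : 0 < e -> (`|x| < toC e :> C) = (sqn x < e ^+ 2).
Proof.
move=> e0; rewrite -(ltr_pXn2r (n:=2))// ?nnegrE ?normr_ge0 ?ler0c ?(ltW e0)//.
by rewrite sqn_norm -rmorphXn ltcR.
Qed.

Lemma rip_inj x y : (forall z, rip x z = rip y z) -> x = y.
Proof.
move=> xy; apply/eqP; rewrite -subr_eq0; apply/eqP/sqn_eq0.
by rewrite /sqn ripBl xy subrr.
Qed.

End One.

(** The discriminant argument behind all Cauchy-Schwarz inequalities below,
    including those for semidefinite forms, where b may vanish. *)
Lemma quad_ge0_disc (a b c : R) : (forall s, 0 <= a + 2 * s * c + s ^+ 2 * b) ->
  0 <= b -> c ^+ 2 <= a * b.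
Proof.
move=> h b0.
have [b0'|b0'] := eqVneq b 0.
  have [->|c0] := eqVneq c 0; first by rewrite b0' expr0n mulr0.
  (* When b = 0 the affine function of s takes the value -1 here. *)
  have := h (- (a + 1) / (2 * c)).
  rewrite b0' mulr0 addr0.
  have -> : a + 2 * (- (a + 1) / (2 * c)) * c = - 1 by field.
  by rewrite lerNr oppr0 ler10.
have bp : 0 < b by rewrite lt_def b0' b0.
have := h (- c / b).
have -> : a + 2 * (- c / b) * c + (- c / b) ^+ 2 * b = (a * b - c ^+ 2) / b by field.
by rewrite pmulr_lge0 ?invr_gt0// subr_ge0.
Qed.

(** The error e is reached with one modulus d for all spaces, so that finitely
    many coordinates can be treated at once. *)
Lemma sqn_lincomb_lt (a : C) (e : R) : 0 < e -> exists2 d : R, 0 < d &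
  forall (K : hilbertType R) (p q r s : K),
    sqn (p - q) < d -> sqn (r - s) < d -> sqn (a *: p + r - (a *: q + s)) < e.
Proof.
move=> e0; set c := complex.Re (`|a| ^+ 2 : C).
have c1 : 0 < `|c| + 1 by rewrite ltr_wpDl.
exists (e / 4 / (`|c| + 1)) => [|K p q r s]; first by rewrite !divr_gt0.
rewrite !ltr_pdivlMr// opprD addrACA -scalerBr => h1 h2.
have := sqn_triangle (a *: (p - q)) 0 (- (r - s)).
rewrite !opprK subr0 add0r sqnZC -/c => /le_lt_trans; apply.
have := sqn_ge0 (p - q); have := sqn_ge0 (r - s); have := ler_norm c.
have := normr_ge0 c; nra.
Qed.

Lemma rip_CS (H : hilbertType R) (x y : H) : rip x y ^+ 2 <= sqn x * sqn y.
Proof.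
apply: quad_ge0_disc (sqn_ge0 _) => s.
have := sqn_ge0 (x + toC s *: y); rewrite sqnD sqnZ ripZr => h.
by rewrite (_ : _ + _ = sqn x + 2 * (s * rip x y) + s ^+ 2 * sqn y)//; ring.
Qed.

Lemma invS_le (m n : nat) : (m <= n)%N -> n.+1%:R^-1 <= m.+1%:R^-1 :> R.
Proof. by move=> mn; rewrite lef_pV2 ?posrE ?ltr0n// ler_nat. Qed.

Lemma sq_small (d c : R) : (forall e, 0 < e -> d ^+ 2 <= c * e) -> d = 0.
Proof.
move=> h; apply/eqP; rewrite -sqrf_eq0; apply/eqP/le_anti; rewrite sqr_ge0 andbT.
apply/ler_addgt0Pr => e e0; rewrite add0r.
have c1 : 0 < `|c| + 1 by rewrite ltr_wpDl.
apply: le_trans (h (e / (`|c| + 1)) _) _; first by rewrite divr_gt0.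
rewrite mulrCA ger_pMr// ler_pdivrMr// mul1r.
by rewrite (le_trans (ler_norm c))// lerDl.
Qed.

Section Topology.
Variable H : hilbertType R.
Implicit Types (x y l : H) (S : set H) (u : nat -> H).

Lemma ball_sqn x (e : C) : 0 < e -> exists2 d : R, 0 < d &
  forall y, sqn (x - y) < d -> ball x e y.
Proof.
move=> e0; have /complex_realP [r er] : e \is Num.real.
  by rewrite ger0_real// ltW.
move: e0; rewrite er ltcR => e0.
exists (r ^+ 2); first by rewrite exprn_gt0.
by move=> y h; rewrite -ball_normE/= sqn_lt_norm.
Qed.

Lemma sqn_ball x (d : R) : 0 < d -> exists2 e : C, 0 < e &
  forall y, ball x e y -> sqn (x - y) < d.
Proof.
move=> d0; exists (toC (Num.sqrt d)); first by rewrite ltcR sqrtr_gt0.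
move=> y; rewrite -ball_normE/= sqn_lt_norm ?sqrtr_gt0//.
by rewrite sqr_sqrtr// ltW.
Qed.

Lemma closure_sqn S x :
  closure S x <-> forall e, 0 < e -> exists2 y, S y & sqn (x - y) < e.
Proof.
split=> [Sx e e0|h B].
  have [d d0 hd] := sqn_ball x e0.
  have [y [Sy xy]] := Sx _ (nbhsx_ballx x d d0).
  by exists y => //; exact: hd.
rewrite -nbhs_ballE => -[e/= e0 eB].
have [d d0 hd] := ball_sqn x e0.
have [y Sy xy] := h _ d0.
by exists y; split => //; apply: eB; exact: hd.
Qed.

(** Convergence with a real modulus: the norm of a Hilbert space takes values
    in R[i], whose order is partial. *)
Definition sqn_lim u l :=
  forall e, 0 < e -> exists N, forall n, (N <= n)%N -> sqn (u n - l) < e.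

Lemma sqn_complete u :
  (forall e, 0 < e -> exists N, forall m n, (N <= m)%N -> (N <= n)%N ->
     sqn (u m - u n) < e) -> exists l, sqn_lim u l.
Proof.
move=> uC.
have : cvgn u.
  apply/cauchy_cvgP/cauchy_exP => e e0.
  have /cid2 [d d0 hd] := ball_sqn (0 : H) e0.
  have [N hN] := uC _ d0.
  exists (u N); exists N => // n /= Nn.
  have := hd (u n - u N); rewrite sub0r sqnN => /(_ (hN _ _ Nn (leqnn _))).
  by rewrite -!ball_normE/= sub0r opprB.
move=> /cvgP uc; exists (lim (u @ \oo)) => e e0.
have [d d0 hd] := sqn_ball (lim (u @ \oo)) e0.
have : nbhs (lim (u @ \oo)) (ball (lim (u @ \oo)) d) by exact: nbhsx_ballx.
move=> /uc [N _ hN]; exists N => n Nn.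
by rewrite sqn_dist; apply: hd; exact: hN.
Qed.

Lemma sqn_lim_unique u l l' : sqn_lim u l -> sqn_lim u l' -> l = l'.
Proof.
move=> ul ul'; apply/eqP; rewrite -subr_eq0; apply/eqP/sqn_eq0/le_anti.
rewrite sqn_ge0 andbT; apply/ler_addgt0Pr => e e0; rewrite add0r.
have e4 : 0 < e / 4 by rewrite divr_gt0.
have [N hN] := ul _ e4; have [M hM] := ul' _ e4.
have := hN _ (leq_maxl N M); have := hM _ (leq_maxr N M).
have := sqn_triangle l (u (maxn N M)) l'; rewrite (sqn_dist l (u _)).
lra.
Qed.

End Topology.
End RealInner.

(** * Families of vectors and the projection lemma *)

(** A dependent family x : forall i, K i stands for the element of the direct
    sum of K 0, ..., K n.-1 given by its first n entries. *)
Section Family.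
Variables (R : realType) (n : nat) (K : nat -> hilbertType R).
Implicit Types x y z p : forall i, K i.

Definition frip x y : R := \sum_(i < n) rip (x i) (y i).
Definition fsqn x : R := \sum_(i < n) sqn (x i).

Lemma fsqn_ge0 x : 0 <= fsqn x.
Proof. by apply: sumr_ge0 => i _; exact: sqn_ge0. Qed.

Lemma fsqn_le x i : (i < n)%N -> sqn (x i) <= fsqn x.
Proof.
move=> ni; rewrite /fsqn (bigD1 (Ordinal ni))//= lerDl.
by apply: sumr_ge0 => j _; exact: sqn_ge0.
Qed.

Lemma fsqn_eq0 x : fsqn x = 0 -> forall i, (i < n)%N -> x i = 0.
Proof.
move=> x0 i ni; apply/sqn_eq0/le_anti; rewrite sqn_ge0 andbT -x0.
exact: fsqn_le.
Qed.

Lemma fsqn_lt x e : 0 < e -> (forall i, (i < n)%N -> sqn (x i) < e / n.+1%:R) ->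
  fsqn x < e.
Proof.
move=> e0 h; have n0 : 0 < n.+1%:R :> R by rewrite ltr0n.
apply: le_lt_trans (_ : \sum_(i < n) e / n.+1%:R < _).
  by apply: ler_sum => i _; apply/ltW/h.
rewrite sumr_const card_ord -[ltLHS]mulr_natr -mulrA gtr_pMr// mulrC ltr_pdivrMr//.
by rewrite mul1r ltr_nat.
Qed.

Lemma frip_CS x y : frip x y ^+ 2 <= fsqn x * fsqn y.
Proof.
apply: quad_ge0_disc (fsqn_ge0 _) => s.
suff -> : fsqn x + 2 * s * frip x y + s ^+ 2 * fsqn y =
    fsqn (fun i => x i + toC s *: y i) by exact: fsqn_ge0.
rewrite /fsqn /frip !mulr_sumr -!big_split/=; apply: eq_bigr => i _.
by rewrite sqnD sqnZ ripZr mulrA.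
Qed.

Lemma fripBr x y z : frip x (fun i => y i - z i) = frip x y - frip x z.
Proof.
by rewrite /frip -sumrB; apply: eq_bigr => i _; rewrite ripBr.
Qed.

Lemma fripBl x y z : frip (fun i => y i - z i) x = frip y x - frip z x.
Proof.
by rewrite /frip -sumrB; apply: eq_bigr => i _; rewrite ripBl.
Qed.

End Family.

Section FamilyRange.
Variables (R : realType) (V : lmodType R[i]).

(** Real linearity is what the orthogonal projection needs, and it also covers
    the real functionals of [riesz]. *)
Definition rlin (K : hilbertType R) (f : V -> K) :=
  forall (a : R) u v, f (toC a *: u + v) = toC a *: f u + f v.

Lemma linear_rlin (K : hilbertType R) (f : V -> K) : linear f -> rlin f.
Proof. by move=> lf a u v; rewrite lf. Qed.

Section One.
Variable (K : hilbertType R) (f : V -> K).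
Hypothesis fl : rlin f.
Lemma rlinD u v : f (u + v) = f u + f v.
Proof. by have := fl 1 u v; rewrite rmorph1 !scale1r. Qed.
Lemma rlin0 : f 0 = 0.
Proof.
have := rlinD 0 0; rewrite addr0 => /eqP.
by rewrite addrC -subr_eq subrr => /eqP.
Qed.
Lemma rlinZ (a : R) u : f (toC a *: u) = toC a *: f u.
Proof. by have := fl a u 0; rewrite rlin0 !addr0. Qed.
Lemma rlinN u : f (- u) = - f u.
Proof. by have := rlinZ (- 1) u; rewrite rmorphN rmorph1 !scaleN1r. Qed.
Lemma rlinB u v : f (u - v) = f u - f v.
Proof. by rewrite rlinD rlinN. Qed.
End One.

(** The closure, in the direct sum, of the range of v |-> (P i v)_(i < n). *)
Definition fam_closure n (K : nat -> hilbertType R) (P : forall i, V -> K i)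
    (x : forall i, K i) :=
  forall e : R, 0 < e -> exists v, forall i, (i < n)%N -> sqn (x i - P i v) < e.

Variables (n : nat) (K : nat -> hilbertType R) (P : forall i, V -> K i).
Hypothesis Pl : forall i, (i < n)%N -> rlin (P i).
Implicit Types x y p : forall i, K i.
Local Notation row v := (fun i => P i v).

Lemma fam_closure_sum x e : fam_closure n P x -> 0 < e ->
  exists v, fsqn n (fun i => x i - P i v) < e.
Proof.
move=> xP e0; have [|v hv] := xP (e / n.+1%:R); first by rewrite divr_gt0.
by exists v; exact: fsqn_lt.
Qed.

Lemma fam_closure_orth x : fam_closure n P x ->
  (forall v, frip n x (row v) = 0) -> forall i, (i < n)%N -> x i = 0.
Proof.
move=> xP x0; apply: fsqn_eq0; apply: (@sq_small _ _ (fsqn n x)) => e e0.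
have [v hv] := fam_closure_sum xP e0.
have {1}-> : fsqn n x = frip n x (fun i => x i - P i v).
  by rewrite fripBr x0 subr0.
apply: le_trans (frip_CS _ _ _) _.
by rewrite ler_wpM2l ?fsqn_ge0// ltW.
Qed.

Lemma cauchy_row (v : nat -> V) :
  (forall e, 0 < e -> exists N, forall a b, (N <= a)%N -> (N <= b)%N ->
    fsqn n (row (v a - v b)) < e) ->
  exists p, forall i, (i < n)%N -> sqn_lim (fun k => P i (v k)) (p i).
Proof.
move=> vC; have h i : exists l : K i, (i < n)%N ->
    sqn_lim (fun k => P i (v k)) l.
  have [ni|] := ltnP i n; last by exists 0.
  have [|l hl] := @sqn_complete _ _ (fun k => P i (v k)); last by exists l.
  move=> e /vC[N hN]; exists N => a b Na Nb.
  rewrite -rlinB; last exact: Pl.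
  by apply: le_lt_trans (hN _ _ Na Nb); exact: (@fsqn_le _ _ _ (row _)).
by exists (fun i => sval (cid (h i))) => i; exact: svalP (cid (h i)).
Qed.

Lemma sqn_lim_all (v : nat -> V) p :
  (forall i, (i < n)%N -> sqn_lim (fun k => P i (v k)) (p i)) ->
  forall e, 0 < e -> exists N, forall k, (N <= k)%N ->
    forall i, (i < n)%N -> sqn (p i - P i (v k)) < e.
Proof.
move=> vp e e0.
have h i : exists N, (i < n)%N -> forall k, (N <= k)%N ->
    sqn (p i - P i (v k)) < e.
  have [ni|] := ltnP i n; last by exists 0%N.
  have [N hN] := vp _ ni e e0; exists N => _ k Nk.
  by rewrite sqn_dist; exact: hN.
pose N i := sval (cid (h i)).
exists (\max_(i < n) N i)%N => k Nk i ni.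
apply: (svalP (cid (h i))) => //.
by apply: leq_trans Nk; exact: (leq_bigmax (Ordinal ni)).
Qed.

Lemma fam_closure_lim (v : nat -> V) p :
  (forall i, (i < n)%N -> sqn_lim (fun k => P i (v k)) (p i)) -> fam_closure n P p.
Proof.
by move=> /sqn_lim_all h e /h[N hN]; exists (v N); exact: hN.
Qed.

(** Orthogonal projection on the closed range of a family of operators.  A
    minimizing sequence v for the distance Q to x has Cauchy images by the
    parallelogram law, and the optimality of Q along v + s w bounds the inner
    product of the residue with the image of w by the discriminant. *)
Lemma fam_closure_proj x :
  exists2 p, fam_closure n P p & forall v, frip n (fun i => x i - p i) (row v) = 0.
Proof.
pose Q v := fsqn n (fun i => x i - P i v).
have Qlb : has_inf (range Q).
  split; first by exists (Q 0), 0.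
  by exists 0 => _ [v _ <-]; exact: fsqn_ge0.
pose d := inf (range Q).
have dQ v : d <= Q v by apply: ge_inf; [exact: Qlb.2 | exists v].
have /choice[v vQ] : forall k : nat, exists v, Q v < d + k.+1%:R^-1.
  move=> k; have k0 : 0 < k.+1%:R^-1 :> R by rewrite invr_gt0.
  by have [_ [v _ <-] hv] := inf_adherent k0 Qlb; exists v.
have Qs u w s : Q (u + toC s *: w) =
    Q u + 2 * s * (- frip n (fun i => x i - P i u) (row w)) +
    s ^+ 2 * fsqn n (row w).
  rewrite /Q /fsqn /frip -sumrN !mulr_sumr -!big_split/=.
  apply: eq_bigr => i _; rewrite (rlinD (Pl (ltn_ord i))) (rlinZ (Pl (ltn_ord i))).
  by rewrite opprD addrA [LHS]sqnB ripZr sqnZ; ring.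
clearbody d Q.
have vorth k w : frip n (fun i => x i - P i (v k)) (row w) ^+ 2 <=
    k.+1%:R^-1 * fsqn n (row w).
  rewrite -sqrrN; apply: quad_ge0_disc (fsqn_ge0 _ _) => s.
  have := vQ k; have := dQ (v k + toC s *: w); rewrite Qs.
  move: k.+1%:R^-1 => t; lra.
have vpar a b : fsqn n (row (v a - v b)) <= 2 * a.+1%:R^-1 + 2 * b.+1%:R^-1.
  (* The parallelogram law: Q is evaluated at the midpoint of v a and v b. *)
  have := dQ (v a + toC (- 2^-1) *: (v a - v b)).
  have := vQ a; have := vQ b.
  rewrite Qs; set c := frip _ _ _.
  have -> : Q (v b) = Q (v a) + 2 * c + fsqn n (row (v a - v b)).
    have {1}-> : v b = v a + toC (- 1) *: (v a - v b).
      by rewrite rmorphN rmorph1 scaleN1r opprB addrC subrK.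
    by rewrite Qs -/c; ring.
  rewrite [(- _) ^+ 2](_ : _ = 4^-1); last by field.
  move: a.+1%:R^-1 b.+1%:R^-1 => ea eb; lra.
have [|p hp] := @cauchy_row v.
  move=> e e0; have e4 : 0 < e / 4 by rewrite divr_gt0.
  have [N] := ltr_add_invr e4; rewrite add0r => hN; exists N => a b Na Nb.
  have := vpar a b; have := invS_le R Na; have := invS_le R Nb.
  move: a.+1%:R^-1 b.+1%:R^-1 N.+1%:R^-1 hN => ea eb eN hN; lra.
exists p; first exact: fam_closure_lim hp.
move=> w; apply: (@sq_small _ _ (4 * fsqn n (row w))) => e e0.
set N := fsqn n (row w).
have [M hM] := sqn_lim_all hp (divr_gt0 e0 (ltr0Sn R n)).
have [M' ] := ltr_add_invr e0; rewrite add0r => hM'.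
pose k := maxn M M'.
have ek : k.+1%:R^-1 < e.
  by apply: le_lt_trans hM'; exact/invS_le/leq_maxr.
(* The residue at p differs by c2 from the residue at v k; both are small. *)
set c := frip n _ _.
pose c1 := frip n (fun i => x i - P i (v k)) (row w).
pose c2 := frip n (fun i => p i - P i (v k)) (row w).
have -> : c = c1 - c2.
  rewrite /c /c1 /c2 -fripBl; apply: eq_bigr => i _.
  by congr rip; rewrite opprB addrA subrK.
have hc1 : c1 ^+ 2 <= e * N.
  by apply: le_trans (vorth k w) _; rewrite ler_wpM2r ?fsqn_ge0// ltW.
have hc2 : c2 ^+ 2 <= e * N.
  apply: le_trans (frip_CS _ _ _) _; rewrite ler_wpM2r ?fsqn_ge0// ltW//.
  by apply: fsqn_lt => // i ni; apply: hM => //; exact: leq_maxl.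
have := sqr_ge0 (c1 + c2); nra.
Qed.

End FamilyRange.

(** If the family P' is dominated by P, then the map sending the P-image of v to
    its P'-image extends to the closure.  Applied in both directions to an
    isometry, this gives its extension and shows that its range is closed. *)
Lemma fam_closure_transfer (R : realType) (V : lmodType R[i])
    n (K : nat -> hilbertType R) (P : forall i, V -> K i)
    n' (K' : nat -> hilbertType R) (P' : forall i, V -> K' i)
    (x : forall i, K i) :
  (forall i, (i < n)%N -> rlin (P i)) -> (forall i, (i < n')%N -> rlin (P' i)) ->
  (forall v, fsqn n' (fun i => P' i v) <= fsqn n (fun i => P i v)) ->
  fam_closure n P x -> exists x' : forall i, K' i, forall e, 0 < e -> exists v,
    (forall i, (i < n)%N -> sqn (x i - P i v) < e) /\
    (forall i, (i < n')%N -> sqn (x' i - P' i v) < e).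
Proof.
move=> Pl P'l PP' xP.
have /choice[v hv] : forall k : nat, exists v, forall i, (i < n)%N ->
    sqn (x i - P i v) < k.+1%:R^-1.
  by move=> k; apply: xP; rewrite invr_gt0.
have [|x' hx'] := cauchy_row (v := v) P'l.
  move=> e e0; have e4 : 0 < e / n.+1%:R / 4 by rewrite !divr_gt0.
  have [N] := ltr_add_invr e4; rewrite add0r => hN; exists N => a b Na Nb.
  apply: le_lt_trans (PP' _) _; apply: fsqn_lt => // i ni.
  rewrite (rlinB (Pl _ ni)).
  have := sqn_triangle (P i (v a)) (x i) (P i (v b)).
  rewrite (sqn_dist (P i (v a)) (x i)).
  have := hv a _ ni; have := hv b _ ni.
  have := invS_le R Na; have := invS_le R Nb.
  move: a.+1%:R^-1 b.+1%:R^-1 N.+1%:R^-1 (e / _) hN => ea eb eN e1 hN; lra.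
exists x' => e e0; have [M hM] := sqn_lim_all hx' e0.
have [N] := ltr_add_invr e0; rewrite add0r => hN.
exists (v (maxn M N)); split=> i ni; last by apply: hM ni; exact: leq_maxl.
apply: lt_trans (hv _ _ ni) _; apply: le_lt_trans hN.
exact/invS_le/leq_maxr.
Qed.

(** * Contractions and their adjoints *)

Section Operators.
Variable R : realType.
Implicit Types H K L : hilbertType R.

Definition contraction H K (B : H -> K) : Prop := linear B /\ contractive B.

Lemma contractive_sqn H K (B : H -> K) :
  contractive B <-> forall x, sqn (B x) <= sqn x.
Proof.
suff h x : (`|B x| <= `|x|) = (sqn (B x) <= sqn x).
  by split=> hB x; [rewrite -h | rewrite h].
by rewrite -(ler_pXn2r (n:=2))// ?nnegrE// !sqn_norm lecR.
Qed.

Lemma contraction_sqn H K (B : H -> K) :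
  contraction B -> forall x, sqn (B x) <= sqn x.
Proof. by case=> _ /contractive_sqn. Qed.

Lemma contraction_rlin H K (B : H -> K) : contraction B -> rlin B.
Proof. by case=> /linear_rlin. Qed.

Lemma linear_im_unit H K (B : H -> K) : linear B ->
  forall x, B ('i%C *: x) = 'i%C *: B x.
Proof.
by move=> lB x; have := lB 'i%C x 0; rewrite (rlin0 (linear_rlin lB)) !addr0.
Qed.

Lemma inner_adj H K (B : H -> K) (S : K -> H) : linear B ->
  (forall x y, rip (B x) y = rip x (S y)) -> forall x y, '[B x, y] = '[x, S y].
Proof. by move=> lB BS x y; rewrite !inner_rip -linear_im_unit// !BS. Qed.

(** With f e != 0, the range of v |-> f(e) v - f(v) e is the kernel of f.  The
    component r of e orthogonal to it represents f up to a scalar. *)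
Lemma riesz H (f : H -> R) :
  (forall (a : R) u v, f (toC a *: u + v) = a * f u + f v) ->
  (exists c, forall x, f x ^+ 2 <= c * sqn x) ->
  exists r, forall x, f x = rip x r.
Proof.
move=> fl [c fb].
have f0 : f 0 = 0.
  by have := fl 1 0 0; rewrite rmorph1 scale1r addr0 mul1r; lra.
have fD u v : f (u + v) = f u + f v.
  by have := fl 1 u v; rewrite rmorph1 scale1r mul1r.
have fZ a u : f (toC a *: u) = a * f u.
  by have := fl a u 0; rewrite f0 !addr0.
have fB u v : f (u - v) = f u - f v.
  have -> : u - v = toC (- 1) *: v + u by rewrite rmorphN rmorph1 scaleN1r addrC.
  by rewrite fl; ring.
have [fe|/existsNP[e /eqP fe]] := pselect (forall e, f e = 0).
  by exists 0 => x; rewrite rip0r fe.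
pose P := fun (_ : nat) v => toC (f e) *: v - toC (f v) *: e.
have Pl i : (i < 1)%N -> rlin (P i).
  move=> _ a u v; rewrite /P fl rmorphD rmorphM scalerDr scalerDl scalerBr.
  rewrite !scalerA opprD.
  by rewrite (mulrC (toC (f e))) addrACA.
have [p pP pe] := fam_closure_proj Pl (fun=> e).
pose r := e - p 0%N.
have fP v : f (P 0%N v) = 0 by rewrite /P fB !fZ mulrC subrr.
have fp : f (p 0%N) = 0.
  apply: (@sq_small _ _ c) => d d0.
  have [v /(_ 0%N isT) hv] := pP _ d0.
  rewrite -[f _]subr0 -(fP v) -fB; apply: le_trans (fb _) _.
  rewrite ler_wpM2l ?ltW//.
  have := fb e; have : 0 < f e ^+ 2 by rewrite exprn_even_gt0.
  by move=> h1 /(lt_le_trans h1); have := sqn_ge0 e; nra.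
have fr : f r = f e by rewrite fB fp subr0.
have rP v : f e * rip v r = f v * rip r e.
  have := pe v; rewrite /frip big_ord_recl big_ord0 addr0 -/r /P ripBr !ripZr.
  by rewrite rip_sym => /eqP; rewrite subr_eq0 => /eqP.
have nr : rip r e = sqn r.
  by have := rP r; rewrite fr => /(mulfI fe).
have nr0 : sqn r != 0.
  by apply: contraNneq fe => /sqn_eq0 r0; rewrite -fr r0 f0.
exists (toC (f e / sqn r) *: r) => x.
by rewrite ripZr mulrAC rP nr mulfK.
Qed.

Lemma adj_exists H K (B : H -> K) : contraction B ->
  exists S : K -> H, forall x y, rip (B x) y = rip x (S y).
Proof.
move=> Bc; suff /choice[S hS] : forall y, exists r, forall x, rip (B x) y = rip x r.
  by exists S.
move=> y; apply: riesz.
  by move=> a u v; rewrite Bc.1 ripDl ripZl.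
exists (sqn y) => x; apply: le_trans (rip_CS _ _) _.
by rewrite mulrC ler_wpM2l ?sqn_ge0// contraction_sqn.
Qed.

Lemma adj_inner H K (B : H -> K) : contraction B ->
  forall x y, '[B x, y] = '[x, adj B y].
Proof.
move=> Bc; have [S hS] := adj_exists Bc.
pose E := [set S : K -> H | forall x y, '[B x, y] = '[x, S y]].
exact: (@xgetPex _ _ E (ex_intro _ S (inner_adj Bc.1 hS))).
Qed.

Lemma adjP H K (B : H -> K) :
  contraction B -> forall x y, rip (B x) y = rip x (adj B y).
Proof. by move=> Bc x y; rewrite /rip adj_inner. Qed.

Lemma adj_contraction H K (B : H -> K) : contraction B -> contraction (adj B).
Proof.
move=> Bc; split; last first.
  apply/contractive_sqn => y; have := rip_CS (B (adj B y)) y.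
  rewrite adjP// -/(sqn _) => h.
  have [->|n0] := eqVneq (sqn (adj B y)) 0; first exact: sqn_ge0.
  have : 0 < sqn (adj B y) by rewrite lt_def n0 sqn_ge0.
  move=> n1; rewrite -(ler_pM2l n1) -expr2; apply: le_trans h _.
  by rewrite ler_wpM2r ?sqn_ge0// contraction_sqn.
move=> a u v; apply: rip_inj => x; rewrite !(rip_sym _ x) /rip.
by rewrite -adj_inner// !linearDr !linearZr_LR/= !adj_inner.
Qed.

Lemma adjK H K (B : H -> K) : contraction B -> adj (adj B) = B.
Proof.
move=> Bc; apply/funext => x; apply: rip_inj => y.
by rewrite rip_sym -(adjP (adj_contraction Bc)) rip_sym -(adjP Bc).
Qed.

Lemma contraction_comp H K L (B : H -> K) (A : K -> L) :
  contraction A -> contraction B -> contraction (A \o B).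
Proof.
move=> Ac Bc; split; first by move=> a u v /=; rewrite Bc.1 Ac.1.
apply/contractive_sqn => x /=.
exact: le_trans (contraction_sqn Ac _) (contraction_sqn Bc _).
Qed.

End Operators.

(** * Limits in a Hilbert space *)

Lemma sqn_lim_rip (R : realType) (H : hilbertType R) (x : H) u l :
  sqn_lim u l -> (fun n => rip (u n) x) @ \oo --> rip l x.
Proof.
move=> ul; apply/cvgrPdist_lt => e e0.
have x1 : 0 < sqn x + 1 by rewrite ltr_wpDl// sqn_ge0.
have [|N hN] := ul (e ^+ 2 / (sqn x + 1)); first by rewrite divr_gt0// exprn_gt0.
exists N => // n /= Nn; rewrite -ripBl.
rewrite -(ltr_pXn2r (n:=2))// ?nnegrE ?normr_ge0 ?(ltW e0)// real_normK ?num_real//.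
apply: le_lt_trans (rip_CS _ _) _; rewrite sqn_dist.
have := hN _ Nn; rewrite ltr_pdivlMr// => h.
have := sqn_ge0 (u n - l); nra.
Qed.

Arguments sqn_lim_rip {R H} x {u l}.

Section Limits.
Variables (R : realType) (H : hilbertType R).
Implicit Types (u v : nat -> H) (l m x : H).

Lemma sqn_lim_lincomb (a : R[i]) u v l m : sqn_lim u l -> sqn_lim v m ->
  sqn_lim (fun n => a *: u n + v n) (a *: l + m).
Proof.
move=> ul vm e e0; have [d d0 hd] := sqn_lincomb_lt a e0.
have [N hN] := ul _ d0; have [M hM] := vm _ d0.
exists (maxn N M) => n; rewrite geq_max => /andP[Nn Mn].
by apply: hd; [exact: hN | exact: hM].
Qed.

Lemma sqn_lim_le u l (c : R) :
  sqn_lim u l -> (forall n, sqn (u n) <= c) -> sqn l <= c.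
Proof.
move=> ul uc; have hl := sqn_lim_rip l ul.
have : rip l l <= (sqn l + c) / 2.
  apply: ler_cvg_to hl (cvg_cst _) _; apply: nearW => n.
  have := sqn_ge0 (u n - l); rewrite sqnB; have := uc n; lra.
by rewrite -/(sqn l); lra.
Qed.

Lemma rip_eq_lim (K : hilbertType R) u l x (v : nat -> K) (m z : K) :
  sqn_lim u l -> sqn_lim v m -> (forall n, rip (u n) x = rip (v n) z) ->
  rip l x = rip m z.
Proof.
move=> ul vm uv; have {}ul := sqn_lim_rip x ul; have {}vm := sqn_lim_rip z vm.
rewrite (_ : (fun n => rip (u n) x) = fun n => rip (v n) z) in ul.
  by apply: (cvg_unique _ ul vm); exact: norm_hausdorff.
exact/funext.
Qed.

Lemma sqn_lim_map (K : hilbertType R) (T : H -> K) c u l : linear T ->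
  (forall x, sqn (T x) <= c * sqn x) -> sqn_lim u l ->
  sqn_lim (fun n => T (u n)) (T l).
Proof.
move=> Tl Tc ul e e0.
have c1 : 0 < `|c| + 1 by rewrite ltr_wpDl.
have [|N hN] := ul (e / (`|c| + 1)); first by rewrite divr_gt0.
exists N => n /hN; rewrite -(rlinB (linear_rlin Tl)) ltr_pdivlMr// => h.
apply: le_lt_trans (Tc _) _.
have := sqn_ge0 (u n - l); have := ler_norm c; nra.
Qed.

End Limits.

(** * The positive square root of 1 - X *)

Section SquareRoot.
Variable R : realType.
Implicit Types H K : hilbertType R.

Definition rip_symmetric H (S : H -> H) := forall x y, rip (S x) y = rip x (S y).

(** If S = 1 - Y, then S^2 = 1 - X if and only if Y = (X + Y^2) / 2; this is the
    iteration for that fixed point, started at 0. *)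
Fixpoint sqrt_iter H (X : H -> H) (n : nat) (h : H) : H :=
  if n is m.+1 then toC 2^-1 *: (X h + sqrt_iter X m (sqrt_iter X m h)) else 0.

(** The same iteration for the number X = 1: its n-th value bounds the norm of
    the n-th iterate for any contraction X. *)
Fixpoint iter_bound (n : nat) : R :=
  if n is m.+1 then 2^-1 * (1 + iter_bound m ^+ 2) else 0.

Lemma iter_bound_ge0 n : 0 <= iter_bound n.
Proof.
by case: n => //= n; rewrite mulr_ge0 ?invr_ge0 ?addr_ge0 ?sqr_ge0.
Qed.

Lemma iter_bound_le1 n : iter_bound n <= 1.
Proof.
elim: n => //= n IH; have := iter_bound_ge0 n; nra.
Qed.

Lemma iter_bound_leS n : iter_bound n <= iter_bound n.+1.
Proof. by have := sqr_ge0 (1 - iter_bound n); rewrite /=; lra. Qed.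

Lemma iter_bound_le m n : (m <= n)%N -> iter_bound m <= iter_bound n.
Proof.
by move=> /(homo_leq (@lexx _ _) (@le_trans _ _) iter_bound_leS).
Qed.

Lemma iter_bound_cauchy (e : R) : 0 < e -> exists N, forall n, (N <= n)%N ->
  iter_bound n - iter_bound N < e.
Proof.
move=> e0; have hs : has_sup (range iter_bound).
  split; first by exists (iter_bound 0%N), 0%N.
  by exists 1 => _ [n _ <-]; exact: iter_bound_le1.
have [_ [N _ <-] hN] := sup_adherent e0 hs.
exists N => n _; have : iter_bound n <= sup (range iter_bound).
  by apply: (sup_upper_bound hs); exists n.
by lra.
Qed.

(** The iterates are polynomials in X, so they inherit every intertwining. *)
Lemma iter_comm H K (X : H -> H) (X' : K -> K) (T : H -> K) : linear T ->
  (forall h, T (X h) = X' (T h)) ->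
  forall n h, T (sqrt_iter X n h) = sqrt_iter X' n (T h).
Proof.
move=> /linear_rlin Tl TX; elim=> [|n IH] h /=; first exact: rlin0.
by rewrite rlinZ// rlinD// TX !IH.
Qed.

Section Fixed.
Variables (H : hilbertType R) (X : H -> H).
Hypotheses (Xc : contraction X) (Xs : rip_symmetric X).
Local Notation Y := (sqrt_iter X).

Lemma iter_linear n : linear (Y n).
Proof.
elim: n => [|n IH] a u v /=; first by rewrite scaler0 addr0.
rewrite Xc.1 !IH addrACA -scalerDr [LHS]scalerDr !scalerA.
by rewrite [a * _]mulrC.
Qed.

Lemma iter_symm n : rip_symmetric (Y n).
Proof.
elim: n => [|n IH] x y /=; first by rewrite rip0l rip0r.
by rewrite ripZl ripZr ripDl ripDr Xs !IH.
Qed.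

Lemma iter_norm n h : `|Y n h| <= toC (iter_bound n) * `|h|.
Proof.
elim: n h => [|n IH] h /=; first by rewrite normr0 mul0r.
rewrite normrZ rmorphM -mulrA ger0_norm ?ler0c ?invr_ge0//.
rewrite ler_wpM2l ?ler0c ?invr_ge0// rmorphD rmorph1 mulrDl mul1r.
apply: le_trans (ler_normD _ _) _; apply: lerD; first exact: Xc.2.
apply: le_trans (IH _) _; rewrite rmorphXn expr2 -mulrA.
by rewrite ler_wpM2l// ler0c iter_bound_ge0.
Qed.

(** Successive differences are polynomials in X with nonnegative coefficients,
    hence dominated by their values at X = 1.  The induction uses
    a^2 - b^2 = a (a - b) + (a - b) b. *)
Lemma iter_step n h :
  `|Y n.+1 h - Y n h| <= toC (iter_bound n.+1 - iter_bound n) * `|h|.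
Proof.
elim: n h => [|n IH] h.
  rewrite /= !subr0 addr0 expr0n/= addr0 mulr1 normrZ.
  by rewrite ger0_norm ?ler0c ?invr_ge0// ler_wpM2l ?ler0c ?invr_ge0//; exact: Xc.2.
have -> : Y n.+2 h - Y n.+1 h =
    toC 2^-1 *: (Y n.+1 (Y n.+1 h - Y n h) + (Y n.+1 (Y n h) - Y n (Y n h))).
  rewrite (rlinB (linear_rlin (iter_linear n.+1))) addrA subrK.
  by rewrite [Y n.+2]lock /= -lock -scalerBr opprD addrACA subrr add0r.
have -> : iter_bound n.+2 - iter_bound n.+1 =
  2^-1 * (iter_bound n.+1 * (iter_bound n.+1 - iter_bound n) +
          (iter_bound n.+1 - iter_bound n) * iter_bound n).
  by rewrite /=; ring.
rewrite normrZ rmorphM -mulrA ger0_norm ?ler0c ?invr_ge0//.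
rewrite ler_wpM2l ?ler0c ?invr_ge0// rmorphD mulrDl.
apply: le_trans (ler_normD _ _) _; apply: lerD.
  apply: le_trans (iter_norm _ _) _.
  rewrite (rmorphM _ (iter_bound n.+1)) -mulrA.
  by rewrite ler_wpM2l ?ler0c ?iter_bound_ge0.
apply: le_trans (IH _) _.
rewrite (rmorphM _ (iter_bound n.+1 - iter_bound n)) -mulrA.
rewrite ler_wpM2l ?ler0c ?subr_ge0 ?iter_bound_leS//.
exact: iter_norm.
Qed.

Lemma iter_dist n m h : (n <= m)%N ->
  `|Y m h - Y n h| <= toC (iter_bound m - iter_bound n) * `|h|.
Proof.
move=> /subnKC <-; elim: (m - n)%N => [|k IH].
  by rewrite addn0 !subrr normr0 mul0r.
rewrite addnS -(subrKA (Y (n + k)%N h)) -(subrKA (iter_bound (n + k))).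
rewrite rmorphD mulrDl; apply: le_trans (ler_normD _ _) _.
by apply: lerD => //; exact: iter_step.
Qed.

Lemma iter_cvg h : exists l, sqn_lim (fun n => Y n h) l.
Proof.
apply: sqn_complete => e e0.
have h1 : 0 < sqn h + 1 by rewrite ltr_wpDl// sqn_ge0.
have [|N hN] := iter_bound_cauchy (e := e / 4 / (sqn h + 1)).
  by rewrite !divr_gt0.
have sqn_dN n : (N <= n)%N -> sqn (Y n h - Y N h) < e / 4.
  move=> Nn; have := hN _ Nn; rewrite ltr_pdivlMr// => hn.
  have d0 : 0 <= iter_bound n - iter_bound N by rewrite subr_ge0 iter_bound_le.
  have d1 : iter_bound n - iter_bound N <= 1.
    by have := iter_bound_le1 n; have := iter_bound_ge0 N; lra.
  apply: le_lt_trans hn.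
  have : sqn (Y n h - Y N h) <= (iter_bound n - iter_bound N) ^+ 2 * sqn h.
    have toCE : toC ((iter_bound n - iter_bound N) ^+ 2 * sqn h) =
        (toC (iter_bound n - iter_bound N) * `|h|) ^+ 2.
      by rewrite exprMn sqn_norm rmorphM rmorphXn.
    rewrite -lecR toCE -sqn_norm lerXn2r ?nnegrE//.
      by rewrite mulr_ge0// ler0c.
    exact: iter_dist.
  move=> /le_trans; apply; have h0 := sqn_ge0 h.
  move: (iter_bound n - iter_bound N) d0 d1 => d d0 d1.
  have : 0 <= d * (1 - d) * sqn h by rewrite !mulr_ge0 ?subr_ge0.
  by lra.
exists N => m n Nm Nn; have := sqn_triangle (Y m h) (Y N h) (Y n h).
rewrite (sqn_dist (Y N h)).
by have := sqn_dN _ Nm; have := sqn_dN _ Nn; lra.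
Qed.

End Fixed.

Definition sqrt_lim H (X : H -> H) (h : H) : H :=
  xget 0 [set l | sqn_lim (fun n => sqrt_iter X n h) l].

Lemma sqrt_limP H (X : H -> H) h : contraction X ->
  sqn_lim (fun n => sqrt_iter X n h) (sqrt_lim X h).
Proof.
move=> Xc; have [l hl] := iter_cvg Xc h.
pose E := [set l | sqn_lim (fun n => sqrt_iter X n h) l].
exact: (@xgetPex _ _ E (ex_intro _ l hl)).
Qed.

Lemma sqrt_lim_comm H K (X : H -> H) (X' : K -> K) (T : H -> K) c :
  contraction X -> contraction X' ->
  linear T -> (forall x, sqn (T x) <= c * sqn x) ->
  (forall h, T (X h) = X' (T h)) ->
  forall h, T (sqrt_lim X h) = sqrt_lim X' (T h).
Proof.
move=> Xc X'c Tl Tb TX h; apply: sqn_lim_unique (sqrt_limP (T h) X'c).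
have := sqn_lim_map Tl Tb (sqrt_limP h Xc).
by under eq_fun do rewrite (iter_comm Tl TX).
Qed.

Section RootOfContraction.
Variables (H : hilbertType R) (X : H -> H).
Hypotheses (Xc : contraction X) (Xs : rip_symmetric X).
Local Notation Y := (sqrt_lim X).

Lemma iter_sqn n h : sqn (sqrt_iter X n h) <= sqn h.
Proof.
rewrite -lecR -!sqn_norm lerXn2r ?nnegrE//.
apply: le_trans (iter_norm Xc _ _) _.
by rewrite ler_piMl// lecR iter_bound_le1.
Qed.

Lemma sqrt_lim_contraction : contraction Y.
Proof.
split=> [a u v|].
  apply: (sqn_lim_unique (sqrt_limP _ Xc)).
  under eq_fun do rewrite (iter_linear Xc).
  exact: sqn_lim_lincomb (sqrt_limP u Xc) (sqrt_limP v Xc).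
apply/contractive_sqn => h; apply: sqn_lim_le (sqrt_limP h Xc) _ => n.
exact: iter_sqn.
Qed.

Lemma sqrt_lim_symm : rip_symmetric Y.
Proof.
move=> x y; rewrite [RHS]rip_sym.
apply: rip_eq_lim (sqrt_limP x Xc) (sqrt_limP y Xc) _ => n.
by rewrite (iter_symm Xs) rip_sym.
Qed.

Lemma sqrt_lim_eq h : Y h + Y h = X h + Y (Y h).
Proof.
suff {1 2}-> : Y h = toC 2^-1 *: (X h + Y (Y h)).
  have half2 : 2^-1 + 2^-1 = 1 :> R by field.
  by rewrite -scalerDl -rmorphD half2 rmorph1 scale1r.
have Yh := sqrt_limP h Xc; have YYh := sqrt_limP (Y h) Xc.
have S1 : sqn_lim (fun n => sqrt_iter X n.+1 h) (Y h).
  by move=> e /Yh[N hN]; exists N => n Nn; apply: hN; exact: leqW.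
apply: (sqn_lim_unique S1) => e e0.
have [N hN] := Yh _ (divr_gt0 e0 (ltr0Sn R 1)).
have [M hM] := YYh _ (divr_gt0 e0 (ltr0Sn R 1)).
exists (maxn N M) => n; rewrite geq_max => /andP[Nn Mn] /=.
rewrite -scalerBr sqnZ [X h + _]addrC addrKA.
have := sqn_triangle (sqrt_iter X n (sqrt_iter X n h)) (sqrt_iter X n (Y h))
  (Y (Y h)).
rewrite -(rlinB (linear_rlin (iter_linear Xc n))).
have : sqn (sqrt_iter X n (sqrt_iter X n h - Y h)) <= sqn (sqrt_iter X n h - Y h).
  exact: iter_sqn.
have := hN _ Nn; have := hM _ Mn; lra.
Qed.

Definition sqrt1B h := h - Y h.

Lemma sqrt1B_linear : linear sqrt1B.
Proof.
move=> a u v; rewrite /sqrt1B sqrt_lim_contraction.1 scalerBr opprD.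
exact: addrACA.
Qed.

Lemma sqrt1B_symm : rip_symmetric sqrt1B.
Proof. by move=> x y; rewrite /sqrt1B ripBl ripBr sqrt_lim_symm. Qed.

Lemma sqrt1BK h : sqrt1B (sqrt1B h) = h - X h.
Proof.
rewrite /sqrt1B (rlinB (contraction_rlin sqrt_lim_contraction)) opprB.
have -> : X h = Y h + Y h - Y (Y h) by rewrite sqrt_lim_eq addrK.
by rewrite opprB opprD -!addrA; congr (_ + _); rewrite addrCA.
Qed.

Lemma sqrt1B_ge0 h : 0 <= rip (sqrt1B h) h.
Proof.
rewrite /sqrt1B ripBl -/(sqn h).
have := sqn_ge0 (Y h - h); rewrite sqnB.
have := contraction_sqn sqrt_lim_contraction h; lra.
Qed.

End RootOfContraction.

End SquareRoot.

(** * Uniqueness of the positive square root, and defect operators *)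

Section PositiveRoot.
Variable R : realType.
Implicit Types H K : hilbertType R.

Lemma bounded_linear_continuous H K (S : H -> K) c : linear S ->
  (forall x, sqn (S x) <= c * sqn x) -> continuous S.
Proof.
move=> Sl Sc x B; rewrite -nbhs_ballE => -[e /= e0 eB].
have [d d0 hd] := ball_sqn (S x) e0.
have c1 : 0 < `|c| + 1 by rewrite ltr_wpDl.
have [e' e'0 he'] := sqn_ball x (divr_gt0 d0 c1).
rewrite -[_ _ _]/(nbhs x (S @^-1` B)) -nbhs_ballE; exists e' => //= y xy.
apply: eB; apply: hd; rewrite -(rlinB (linear_rlin Sl)).
apply: le_lt_trans (Sc _) _; have := he' _ xy; rewrite ltr_pdivlMr// => h.
have := sqn_ge0 (x - y); have := ler_norm c; nra.
Qed.

Lemma symm_inner_real H (S : H -> H) x : linear S -> rip_symmetric S ->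
  '[S x, x] = toC (rip (S x) x).
Proof.
move=> Sl Ss; rewrite inner_rip -linear_im_unit// (Ss ('i%C *: x)).
have -> : rip ('i%C *: x) (S x) = 0.
  have := ripii ('i%C *: x) (S x); rewrite scalerA -linear_im_unit//.
  rewrite -expr2 (_ : 'i%C ^+ 2 = -1 :> R[i]) ?scaleN1r; last first.
    by rewrite expr2; simpc.
  by rewrite ripNl -Ss rip_sym; lra.
by rewrite oppr0.
Qed.

(** Polarization: [rip ('i *: S z) z] is minus the imaginary part of <S z, z>,
    so it vanishes for all z, in particular for z = x + i y. *)
Lemma positive_symm H (S : H -> H) : positive_op S -> rip_symmetric S.
Proof.
move=> [Sl _ Sp] x y.
have im0 z : rip ('i%C *: S z) z = 0.
  have := Sp z; rewrite inner_rip lecE/= => /andP[/eqP]; lra.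
have /linear_rlin Srl := Sl.
have := im0 (x + 'i%C *: y); rewrite (rlinD Srl) (linear_im_unit Sl) scalerDr.
rewrite !ripDl !ripDr im0 ripii -(linear_im_unit Sl) im0.
rewrite (linear_im_unit Sl) scalerA -expr2 (_ : 'i%C ^+ 2 = -1 :> R[i]); last first.
  by rewrite expr2; simpc.
by rewrite scaleN1r ripNl (rip_sym x (S y)); lra.
Qed.

(** Cauchy-Schwarz for the semidefinite form [rip (S _) _]. *)
Lemma semipos_null H (S : H -> H) : linear S -> rip_symmetric S ->
  (forall x, 0 <= rip (S x) x) -> forall x, rip (S x) x = 0 -> S x = 0.
Proof.
move=> /linear_rlin Sl Ss Sp x x0; apply: sqn_eq0.
have : rip (S x) (S x) ^+ 2 <= rip (S (S x)) (S x) * 0.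
  apply: quad_ge0_disc => // s.
  have := Sp (S x + toC s *: x); rewrite rlinD// rlinZ//.
  by rewrite ripDl !ripDr !ripZl !ripZr x0 (Ss (S x) x); lra.
rewrite mulr0 => h; apply/eqP; rewrite -sqrf_eq0; apply/eqP/le_anti.
by rewrite h sqr_ge0.
Qed.

Section Root.
Variables (H : hilbertType R) (X : H -> H).
Hypotheses (Xc : contraction X) (Xs : rip_symmetric X).

Lemma sqrt1B_bounded h : sqn (sqrt1B X h) <= 2 * sqn h.
Proof.
rewrite /sqn sqrt1B_symm// sqrt1BK// ripBr.
have := sqn_ge0 (h + X h); rewrite sqnD; have := contraction_sqn Xc h.
rewrite /sqn; lra.
Qed.

Lemma sqrt1B_positive : positive_op (sqrt1B X).
Proof.
split; first exact: sqrt1B_linear.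
- exact: bounded_linear_continuous (sqrt1B_linear Xc) sqrt1B_bounded.
- move=> x; have Sl := sqrt1B_linear Xc; have Ss := sqrt1B_symm Xc Xs.
  by rewrite symm_inner_real// ler0c; exact: sqrt1B_ge0.
Qed.

(** A square root S of 1 - X commutes with X, hence with the root T built
    above.  For y = T h - S h this gives T y + S y = (T^2 - S^2) h = 0, so
    positivity forces T y = S y = 0, and then <y, y> = <h, T y - S y> = 0. *)
Lemma sqrt1B_unique S :
  positive_op S -> S \o S = (fun h => h - X h) -> S = sqrt1B X.
Proof.
move=> Sp SS; have Ss := positive_symm Sp; have [Sl _ Sp0] := Sp.
have SSE h : S (S h) = h - X h by rewrite -[S _]/((S \o S) h) SS.
have /linear_rlin Srl := Sl.
have Sb x : sqn (S x) <= 2 * sqn x.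
  rewrite /sqn Ss SSE ripBr.
  have := sqn_ge0 (x + X x); rewrite sqnD; have := contraction_sqn Xc x.
  rewrite /sqn; lra.
have SX h : S (X h) = X (S h).
  have -> : X h = h - S (S h) by rewrite SSE subKr.
  by rewrite rlinB// SSE subKr.
have SY h : S (sqrt1B X h) = sqrt1B X (S h).
  by rewrite /sqrt1B rlinB// (sqrt_lim_comm Xc Xc Sl Sb SX).
have Rl := sqrt1B_linear Xc; have /linear_rlin Rrl := Rl.
have Sre x : 0 <= rip (S x) x.
  by have := Sp0 x; rewrite symm_inner_real// ler0c.
apply/funext => h; apply/eqP; rewrite eq_sym -subr_eq0; apply/eqP/sqn_eq0.
set y := sqrt1B X h - S h.
have y0 : sqrt1B X y + S y = 0.
  rewrite /y (rlinB Rrl) (rlinB Srl) sqrt1BK// SSE SY.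
  by rewrite addrA subrK subrr.
have yy : rip (sqrt1B X y) y + rip (S y) y = 0 by rewrite -ripDl y0 rip0l.
have Ry := sqrt1B_ge0 Xc y; have Sy := Sre y.
have Ry0 : sqrt1B X y = 0.
  by apply: (semipos_null Rl (sqrt1B_symm Xc Xs) (sqrt1B_ge0 Xc)); lra.
have Sy0 : S y = 0 by apply: (semipos_null Sl Ss Sre); lra.
by rewrite /sqn {1}/y ripBl sqrt1B_symm// Ss Ry0 Sy0 rip0r subrr.
Qed.

Lemma op_sqrt1B : op_sqrt (fun h => h - X h) = sqrt1B X.
Proof.
have ex : [set S | positive_op S /\ S \o S = (fun h => h - X h)] (sqrt1B X).
  by split; [exact: sqrt1B_positive | apply/funext => h /=; exact: sqrt1BK].
have [Sp SS] := xgetPex (fun=> 0) (ex_intro _ _ ex).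
exact: sqrt1B_unique.
Qed.

End Root.

Section Defect.
Variables (H K : hilbertType R) (B : H -> K).
Hypothesis Bc : contraction B.

Lemma gram_contraction : contraction (adj B \o B).
Proof. by apply: contraction_comp => //; exact: adj_contraction. Qed.

Lemma gram_symm : rip_symmetric (adj B \o B).
Proof. by move=> x y /=; rewrite rip_sym -adjP// rip_sym adjP. Qed.

Lemma defectE : defect B = sqrt1B (adj B \o B).
Proof. exact: op_sqrt1B gram_contraction gram_symm. Qed.

Lemma defect_symm : rip_symmetric (defect B).
Proof. by rewrite defectE; exact: sqrt1B_symm gram_contraction gram_symm. Qed.

Lemma defectK h : defect B (defect B h) = h - adj B (B h).
Proof. by rewrite defectE (sqrt1BK gram_contraction). Qed.

Lemma rip_defect x y :
  rip (defect B x) (defect B y) = rip x y - rip (B x) (B y).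
Proof. by rewrite defect_symm defectK ripBr -adjP. Qed.

Lemma sqn_defect x : sqn (defect B x) = sqn x - sqn (B x).
Proof. exact: rip_defect. Qed.

Lemma defect_contraction : contraction (defect B).
Proof.
split; first by rewrite defectE; apply: sqrt1B_linear; exact: gram_contraction.
by apply/contractive_sqn => x; rewrite sqn_defect gerBl sqn_ge0.
Qed.

End Defect.

(** B intertwines B^* B and B B^*, hence also the square roots of their
    complements. *)
Lemma defect_comm H K (B : H -> K) : contraction B ->
  forall h, B (defect B h) = defect (adj B) (B h).
Proof.
move=> Bc h; have B'c := adj_contraction Bc; rewrite !defectE// /sqrt1B adjK//.
rewrite (rlinB (contraction_rlin Bc)); congr (_ - _).
apply: (sqrt_lim_comm (c := 1)) => //; first exact: gram_contraction.
- by have := gram_contraction B'c; rewrite adjK.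
- exact: Bc.1.
- by move=> x; rewrite mul1r; exact: contraction_sqn.
Qed.

End PositiveRoot.

(** * Ranges of defect operators *)

Section Ranges.
Variable R : realType.
Implicit Types H K : hilbertType R.

Lemma fam_closure1 H K (D : H -> K) x :
  fam_closure 1 (K := fun=> K) (fun=> D) (fun=> x) <-> closure (range D) x.
Proof.
rewrite closure_sqn; split=> [h e /h[v /(_ 0%N isT) hv]|h e /h[_ [v _ <-] hv]].
  by exists (D v) => //; exists v.
by exists v.
Qed.

Lemma closure_range_lincomb H K (f : H -> K) (a : R[i]) x y : linear f ->
  closure (range f) x -> closure (range f) y -> closure (range f) (a *: x + y).
Proof.
move=> fl /closure_sqn xf /closure_sqn yf; apply/closure_sqn => e e0.
have [d d0 hd] := sqn_lincomb_lt a e0.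
have [_ [u _ <-] hu] := xf _ d0; have [_ [v _ <-] hv] := yf _ d0.
exists (f (a *: u + v)); first by exists (a *: u + v).
by rewrite fl; exact: hd.
Qed.

Lemma closure_rangeB H K (f : H -> K) x y : linear f ->
  closure (range f) x -> closure (range f) y -> closure (range f) (x - y).
Proof.
by move=> fl fx fy; rewrite addrC -scaleN1r; exact: closure_range_lincomb.
Qed.

(** The kernel of a symmetric operator is orthogonal to its range. *)
Lemma closure_range_null H (D : H -> H) x : contraction D -> rip_symmetric D ->
  closure (range D) x -> D x = 0 -> x = 0.
Proof.
move=> Dc Ds /fam_closure1 xD x0.
apply: (fam_closure_orth (x := fun=> x) xD _ (ltn0Sn 0)) => v.
by rewrite /frip big_ord_recl big_ord0 addr0 -Ds x0 rip0l.
Qed.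

(** Projecting h on the closed range changes it by a vector in the kernel. *)
Lemma range_closure H (D : H -> H) h : contraction D -> rip_symmetric D ->
  exists2 x, closure (range D) x & D x = D h.
Proof.
move=> Dc Ds.
have [p pD hp] := fam_closure_proj (n := 1) (K := fun=> H) (P := fun=> D)
  (fun _ _ => contraction_rlin Dc) (fun=> h).
have D0 v : rip (h - p 0%N) (D v) = 0.
  by have := hp v; rewrite /frip big_ord_recl big_ord0 addr0.
exists (p 0%N).
  by apply/fam_closure1 => e /pD[v hv]; exists v => -[|//] _; exact: hv.
apply/esym/eqP; rewrite -subr_eq0 -(rlinB (contraction_rlin Dc)); apply/eqP/sqn_eq0.
by rewrite /sqn Ds D0.
Qed.

(** The vectors (x, y) with D1 x + D2 y = 0 are those orthogonal to all pairs
    (D1 h, D2 h), when D1 and D2 are symmetric. *)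
Definition joint_kernel_trivial H (D1 D2 : H -> H) := forall x y,
  closure (range D1) x -> closure (range D2) y -> D1 x + D2 y = 0 ->
  x = 0 /\ y = 0.

Section Two.
Variables (H : hilbertType R) (D1 D2 : H -> H).
Hypotheses (D1c : contraction D1) (D1s : rip_symmetric D1).
Hypotheses (D2c : contraction D2) (D2s : rip_symmetric D2).

Lemma joint_kernelP :
  joint_kernel_trivial D1 D2 <-> range D1 `&` range D2 = [set 0].
Proof.
have R0 : range D1 0 /\ range D2 0.
  by split; exists 0; rewrite ?(rlin0 (contraction_rlin _)).
split=> [J|I x y xD yD xy].
  apply/seteqP; split=> [u [[x _ <-] [y _ yx]]|_ ->//].
  have [x' x'D x'E] := range_closure x D1c D1s.
  have [y' y'D y'E] := range_closure (- y) D2c D2s.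
  have xy0 : D1 x' + D2 y' = 0.
    by rewrite x'E y'E (rlinN (contraction_rlin D2c)) yx subrr.
  have [x'0 _] := J x' y' x'D y'D xy0.
  by rewrite /= -x'E x'0 (rlin0 (contraction_rlin D1c)).
have D10 : D1 x = 0.
  suff : (range D1 `&` range D2) (D1 x) by rewrite I.
  split; first by exists x.
  exists (- y) => //; rewrite (rlinN (contraction_rlin D2c)).
  by apply/esym/eqP; rewrite -addr_eq0 xy.
split; first exact: closure_range_null xD D10.
by apply: closure_range_null yD _ => //; rewrite -xy D10 add0r.
Qed.

Let P (i : nat) : H -> H := if i is 0%N then D1 else D2.
Let Pl i : (i < 2)%N -> rlin (P i).
Proof. by case: i => [|i] _; exact: contraction_rlin. Qed.
Let pair_fun (x y : H) (i : nat) : H := if i is 0%N then x else y.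

Let frip2 (x y v : H) :
  frip 2 (pair_fun x y) (fun i => P i v) = rip (D1 x + D2 y) v.
Proof. by rewrite ripDl D1s D2s /frip !big_ord_recl big_ord0 addr0. Qed.

Lemma closure_pairP (x y : H) :
  closure [set (D1 h, D2 h) | h in [set: H]] (x, y) <->
  fam_closure 2 P (pair_fun x y).
Proof.
split=> [h e e0|h].
  have [d d0 hd] := sqn_ball x e0; have [d' d'0 hd'] := sqn_ball y e0.
  have /h[_ [[v _ <-] [/= v1 v2]]] : nbhs (x, y) (ball x d `*` ball y d').
    by exists (ball x d, ball y d') => //; split; exact: nbhsx_ballx.
  by exists v => -[_|[_|//]]; [exact: hd | exact: hd'].
move=> B [[B1 B2] /= [b1 b2] BB].
move: b1 b2; rewrite -!nbhs_ballE => -[e1 /= e10 eB1] [e2 /= e20 eB2].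
have [d1 d10 hd1] := ball_sqn x e10; have [d2 d20 hd2] := ball_sqn y e20.
have d0 : 0 < Num.min d1 d2 by rewrite lt_min d10.
have [v hv] := h _ d0; exists (D1 v, D2 v); split; first by exists v.
apply: BB; split=> /=.
  by apply/eB1/hd1; apply: lt_le_trans (hv 0%N isT) _; rewrite ge_min lexx.
by apply/eB2/hd2; apply: lt_le_trans (hv 1%N isT) _; rewrite ge_min lexx orbT.
Qed.

Lemma dense_pairP :
  closure [set (D1 h, D2 h) | h in [set: H]] =
    closure (range D1) `*` closure (range D2) <->
  joint_kernel_trivial D1 D2.
Proof.
split=> [cl x y xD yD xy|J].
  have /closure_pairP xyP : closure [set (D1 h, D2 h) | h in [set: H]] (x, y).
    by rewrite cl.
  have xy0 := fam_closure_orth xyP _.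
  have {}xy0 i : (i < 2)%N -> pair_fun x y i = 0.
    by apply: xy0 => v; rewrite frip2 xy rip0l.
  by split; [exact: (xy0 0%N) | exact: (xy0 1%N)].
have sub x y : fam_closure 2 P (pair_fun x y) ->
    closure (range D1) x /\ closure (range D2) y.
  move=> h; split; apply/closure_sqn => e /h[v hv].
    by exists (D1 v); [exists v | exact: (hv 0%N isT)].
  by exists (D2 v); [exists v | exact: (hv 1%N isT)].
apply/seteqP; split=> -[x y]; first by move=> /closure_pairP/sub.
move=> [/= xD yD]; apply/closure_pairP.
have [p pP hp] := fam_closure_proj Pl (pair_fun x y).
have pE : fam_closure 2 P (pair_fun (p 0%N) (p 1%N)).
  by move=> e /pP[v hv]; exists v => -[_|[_|//]]; [exact: (hv 0%N)|exact: (hv 1%N)].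
have [p0 p1] := sub _ _ pE.
have xyp0 : D1 (x - p 0%N) + D2 (y - p 1%N) = 0.
  apply: rip_inj => v; rewrite rip0l -frip2 -[RHS](hp v).
  by apply: eq_bigr => -[[|[|//]]].
have xpD := closure_rangeB D1c.1 xD p0; have ypD := closure_rangeB D2c.1 yD p1.
have [/eqP + /eqP] := J _ _ xpD ypD xyp0.
by rewrite !subr_eq0 => /eqP -> /eqP ->.
Qed.
End Two.

(** If C^* u = D_C v, then u = C C^* u + D_(C^* )^2 u = D_(C^* ) (C v + D_(C^* ) u)
    because C D_C = D_(C^* ) C; conversely C^* D_(C^* ) w = D_C C^* w. *)
Lemma adj_defect_range H K (C : H -> K) (u : K) : contraction C ->
  range (defect C) (adj C u) <-> range (defect (adj C)) u.
Proof.
move=> Cc; have C'c := adj_contraction Cc.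
have C'l := contraction_rlin (defect_contraction C'c).
split=> -[v _ hv].
  exists (C v + defect (adj C) u) => //.
  rewrite (rlinD C'l) -defect_comm// hv defectK// adjK//.
  by rewrite addrC subrK.
exists (adj C v) => //.
by rewrite -{1}(adjK Cc) -defect_comm// hv.
Qed.

End Ranges.

(** * The isometry of a factorization *)

Section Chain.
Variables (R : realType) (H : nat -> hilbertType R).
Variables (A : forall i, {linear H i -> H i.+1}) (k : nat).
Hypothesis A_contr : forall i, (i < k)%N -> contractive (A i).

Lemma factor_contraction i : (i < k)%N -> contraction (A i).
Proof. by move=> ik; split; [exact: linearP | exact: A_contr]. Qed.

Lemma chain_contraction j : (j <= k)%N -> contraction (chain A j).
Proof.
elim: j => [|j IH] jk /=; first by split.
by apply: contraction_comp; [exact: factor_contraction | exact/IH/ltnW].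
Qed.

(** The vectors whose direct sum is Z_k (D_A h). *)
Definition row (h : H 0%N) (i : nat) : H i := defect (A i) (chain A i h).
Local Notation D := (defect (chain A k)).

Lemma row_contraction i : (i < k)%N -> contraction (row^~ i).
Proof.
move=> ik; apply: (@contraction_comp _ _ _ _ (chain A i) (defect (A i))).
  exact/defect_contraction/factor_contraction.
exact/chain_contraction/ltnW.
Qed.

Lemma row_rlin i : (i < k)%N -> rlin (row^~ i).
Proof. by move=> /row_contraction; exact: contraction_rlin. Qed.

Let Dlc : contraction D. Proof. exact/defect_contraction/chain_contraction. Qed.

(** The sum telescopes. *)
Lemma frip_row_le m h g : (m <= k)%N ->
  frip m (row h) (row g) = rip h g - rip (chain A m h) (chain A m g).
Proof.
elim: m => [|m IH] mk; first by rewrite /frip big_ord0 subrr.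
rewrite /frip big_ord_recr/= -/(frip m _ _) IH ?(ltnW mk)//.
by rewrite /row rip_defect; [rewrite addrA subrK | exact: factor_contraction].
Qed.

Lemma frip_row h g : frip k (row h) (row g) = rip (D h) (D g).
Proof. by rewrite frip_row_le// rip_defect//; exact: chain_contraction. Qed.

(** The closure of the graph of the isometry D h |-> [row h]. *)
Definition Zrel (y : H 0%N) (z : forall i, H i) := forall e : R, 0 < e ->
  exists h, sqn (y - D h) < e /\ forall i, (i < k)%N -> sqn (z i - row h i) < e.

Lemma Zrel_dom y z : Zrel y z -> closure (range D) y.
Proof.
by move=> yz; apply/closure_sqn => e /yz[h [yh _]]; exists (D h) => //; exists h.
Qed.

Lemma Zrel_cod y z : Zrel y z -> fam_closure k (fun i h => row h i) z.
Proof. by move=> yz e /yz[h [_ zh]]; exists h. Qed.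

Lemma row_cod z : fam_closure k (fun i h => row h i) z ->
  forall i, (i < k)%N -> defect_space (A i) (z i).
Proof.
move=> zr i ik; apply/closure_sqn => e /zr[h zh].
by exists (row h i); [exists (chain A i h) | exact: zh].
Qed.

Lemma Zrel_total y : closure (range D) y -> exists z, Zrel y z.
Proof.
move=> /fam_closure1 yD.
have [||v|z hz] := fam_closure_transfer (n := 1) (K := fun=> H 0%N) (P := fun=> D)
  (n' := k) (K' := H) (P' := fun i h => row h i) _ _ _ yD.
- by move=> _ _; exact: contraction_rlin.
- exact: row_rlin.
- rewrite [leRHS]/fsqn big_ord_recl big_ord0 addr0 /sqn -frip_row; exact: lexx.
exists z => e /hz[h [yh zh]]; exists h; split=> //; exact: (yh 0%N).
Qed.

Lemma Zrel_surj z : fam_closure k (fun i h => row h i) z -> exists y, Zrel y z.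
Proof.
move=> zr.
have [||v|y hy] := fam_closure_transfer (n' := 1) (K' := fun=> H 0%N) (P' := fun=> D)
  (n := k) (K := H) (P := fun i h => row h i) _ _ _ zr.
- exact: row_rlin.
- by move=> _ _; exact: contraction_rlin.
- rewrite [leLHS]/fsqn big_ord_recl big_ord0 addr0 /sqn -frip_row; exact: lexx.
exists (y 0%N) => e /hy[h [zh yh]]; exists h; split=> //; exact: (yh 0%N).
Qed.

Lemma Zrel_row h : Zrel (D h) (row h).
Proof. by move=> e e0; exists h; split=> [|i _]; rewrite subrr sqn0. Qed.

Lemma Zrel_lincomb (a : R[i]) y z y' z' : Zrel y z -> Zrel y' z' ->
  Zrel (a *: y + y') (fun i => a *: z i + z' i).
Proof.
move=> yz yz' e e0.
have [d d0 hd] := sqn_lincomb_lt a e0.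
have [u [yu zu]] := yz _ d0; have [v [yv zv]] := yz' _ d0.
exists (a *: u + v); split=> [|i ik]; first by rewrite Dlc.1; exact: hd.
by rewrite (row_contraction ik).1; apply: hd; [exact: zu | exact: zv].
Qed.

(** Both sides are continuous in (y, z) and agree on the graph of the isometry. *)
Lemma Zrel_frip y z y' z' : Zrel y z ->
  (forall h, frip k z' (row h) = rip y' (D h)) -> frip k z' z = rip y' y.
Proof.
move=> yz h; apply/eqP; rewrite -subr_eq0; apply/eqP.
apply: (@sq_small _ _ (2 * fsqn k z' + 2 * sqn y')) => e e0.
have k1 : 0 < k.+1%:R :> R by rewrite ltr0n.
have [|v [yv zv]] := yz (e / k.+1%:R); first by rewrite divr_gt0.
have -> : frip k z' z - rip y' y =
    frip k z' (fun i => z i - row v i) - rip y' (y - D v).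
  by rewrite fripBr ripBr h opprB addrA subrK.
have := frip_CS k z' (fun i => z i - row v i).
have := rip_CS y' (y - D v).
have : fsqn k (fun i => z i - row v i) < e by exact: fsqn_lt.
have : sqn (y - D v) < e.
  by apply: lt_le_trans yv _; rewrite ler_pdivrMr// ler_peMr ?(ltW e0)// ler1n.
have := fsqn_ge0 k z'; have := sqn_ge0 y'.
move: (frip _ _ _) (rip _ _) (fsqn k z') (sqn y') (fsqn _ _) (sqn _) => p q f1 n1 f2 n2.
move=> h1 h2 h3 h4 h5 h6; have := sqr_ge0 (p + q); nra.
Qed.

Lemma Zrel_adj y z : Zrel y z -> forall h, frip k z (row h) = rip y (D h).
Proof.
move=> yz h; rewrite rip_sym -(Zrel_frip yz (frip_row h)).
by apply: eq_bigr => i _; rewrite rip_sym.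
Qed.

Lemma Zrel_norm y z : Zrel y z -> fsqn k z = sqn y.
Proof. by move=> yz; exact: Zrel_frip yz (Zrel_adj yz). Qed.

Lemma Zrel_uniq y z z' : Zrel y z -> Zrel y z' ->
  forall i, (i < k)%N -> z i = z' i.
Proof.
move=> yz yz' i ik; have := Zrel_lincomb (- 1) yz yz'.
rewrite scaleN1r addrC subrr => /Zrel_norm; rewrite sqn0 => /fsqn_eq0/(_ i ik).
by rewrite scaleN1r addrC => /eqP; rewrite subr_eq0 => /eqP.
Qed.

(** The rows span a dense subspace of the sum of the defect spaces. *)
Definition row_total := forall x : forall i, H i,
  (forall i, (i < k)%N -> defect_space (A i) (x i)) ->
  (forall h, frip k x (row h) = 0) -> forall i, (i < k)%N -> x i = 0.

(** Families indexed by nat are used throughout, since passing from k to k + 1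
    then needs no cast; this embeds the families indexed by 'I_k. *)
Definition extend (x : forall i : 'I_k, H i) (i : nat) : H i :=
  if pselect (i < k)%N is left ik then x (Ordinal ik) else 0.

Lemma extendE x (i : 'I_k) : extend x i = x i.
Proof.
rewrite /extend; case: i => i ik /=; case: pselect => // ik'.
by rewrite (bool_irrelevance ik' ik).
Qed.

Lemma extend_cod x : defect_sum A x ->
  forall i, (i < k)%N -> defect_space (A i) (extend x i).
Proof.
by move=> xd i ik; have := xd (Ordinal ik); rewrite -(extendE x (Ordinal ik)).
Qed.

(** If Z is onto then every x in the sum is Z y, and approximating y by vectors
    D h approximates x by rows. *)
Lemma regular_row_total : k_regular A k -> row_total.
Proof.
move=> [Z [Zl Zn _ Zd] Zs] x xd x0.
have : defect_sum A (fun i : 'I_k => x i) by move=> i; exact: xd.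
rewrite -Zs => -[y yD Zy].
suff xr : fam_closure k (fun i h => row h i) x by exact: fam_closure_orth xr x0.
have Zns w : closure (range D) w -> \sum_(i < k) sqn (Z w i) = sqn w.
  move=> wD; apply: (@complexI R); rewrite rmorph_sum -sqn_norm -Zn//.
  by apply: eq_bigr => i _; rewrite sqn_norm.
move=> e e0; have /closure_sqn/(_ e e0)[_ [h _ <-] yh] := yD.
exists h => i ik; apply: le_lt_trans yh.
have Dh : closure (range D) (D h) by apply: subset_closure; exists h.
have yDh := closure_range_lincomb (a := - 1) Dlc.1 Dh yD.
have -> : y - D h = - 1 *: D h + y by rewrite scaleN1r addrC.
rewrite -(Zns _ yDh) (bigD1 (Ordinal ik))//= Zl// Zd Zy scaleN1r addrC.
by rewrite [_ + x i]addrC lerDr sumr_ge0// => j _; exact: sqn_ge0.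
Qed.

(** Z is read off from [Zrel]; it is onto because the projection of any z on the
    closure of the rows leaves a residue orthogonal to all rows. *)
Lemma row_total_regular : row_total -> k_regular A k.
Proof.
move=> tot.
have /choice[g hg] : forall y, exists z, closure (range D) y -> Zrel y z.
  move=> y; have [/Zrel_total[z hz]|nD] := pselect (closure (range D) y).
    by exists z.
  by exists (fun=> 0).
have gcod y : closure (range D) y -> defect_sum A (fun i : 'I_k => g y i).
  by move=> /hg/Zrel_cod/row_cod gy i; exact: gy.
exists (fun y (i : 'I_k) => g y i).
  split=> [a x y xD yD i|x xD|_ [y yD <-]|h i].
  - have xyD := closure_range_lincomb (a := a) Dlc.1 xD yD.
    exact: Zrel_uniq (hg _ xyD) (Zrel_lincomb a (hg _ xD) (hg _ yD)) _ (ltn_ord i).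
  - rewrite sqn_norm -(Zrel_norm (hg _ xD)) rmorph_sum.
    by apply: eq_bigr => i _; rewrite sqn_norm.
  - exact: gcod.
  - have Dh : closure (range D) (D h) by apply: subset_closure; exists h.
    exact: Zrel_uniq (hg _ Dh) (Zrel_row h) _ (ltn_ord i).
apply/seteqP; split=> [_ [y yD <-]|z zd]; first exact: gcod.
have [p pr hp] := fam_closure_proj row_rlin (extend z).
have zp i : (i < k)%N -> extend z i = p i.
  move=> ik; apply/eqP; rewrite -subr_eq0; apply/eqP.
  apply: (tot (fun i => extend z i - p i)) => // j jk.
  apply: closure_rangeB (defect_contraction (factor_contraction jk)).1 _ _.
    exact: extend_cod.
  exact: row_cod.
have [y yp] := Zrel_surj pr; exists y; first exact: Zrel_dom yp.
apply: functional_extensionality_dep => i.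
rewrite -extendE zp//.
exact: (Zrel_uniq (hg y (Zrel_dom yp)) yp (ltn_ord i)).
Qed.

End Chain.

(** * Adding one factor *)

Section Step.
Variables (R : realType) (H : nat -> hilbertType R).
Variables (A : forall i, {linear H i -> H i.+1}) (k : nat).
Hypothesis A_contr : forall i, (i < k.+1)%N -> contractive (A i).
Let A_contr' i : (i < k)%N -> contractive (A i).
Proof. by move=> /ltnW; exact: A_contr. Qed.
Local Notation C := (chain A k).
Local Notation DA := (defect (A k)).

Let Ck : contraction C. Proof. exact: (chain_contraction A_contr'). Qed.
Let Ak : contraction (A k). Proof. exact: (factor_contraction A_contr (ltnSn k)). Qed.
Let DAc : contraction DA. Proof. exact: defect_contraction. Qed.
Let DAs : rip_symmetric DA. Proof. exact: defect_symm. Qed.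
Let DCc : contraction (defect C). Proof. exact: defect_contraction. Qed.
Let DCs : rip_symmetric (defect C). Proof. exact: defect_symm. Qed.

Lemma row_total_pred : row_total A k.+1 -> row_total A k.
Proof.
move=> tot x xd x0 i ik.
pose x' j := if (j < k)%N then x j else 0.
suff : x' i = 0 by rewrite /x' ik.
apply: tot (ltnW ik) => [j jk|h].
  rewrite /x'; case: ifP => [/xd//|_]; apply: subset_closure; exists 0 => //.
  exact: (rlin0 (contraction_rlin (defect_contraction (factor_contraction A_contr jk)))).
rewrite /frip big_ord_recr/= /x' ltnn rip0l addr0 -[RHS](x0 h).
by apply: eq_bigr => j _; rewrite ltn_ord.
Qed.

(** A family x of length k + 1 is orthogonal to all rows if and only if
    C^* (DA (x k)) = defect C y, where y represents minus the functional of the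
    first k entries; by [adj_defect_range] this confines DA (x k) to the
    intersection of the two ranges. *)
Lemma row_totalS :
  row_total A k.+1 <->
  row_total A k /\ range DA `&` range (defect (adj C)) = [set 0].
Proof.
split=> [tot|[tot I]].
  split; first exact: row_total_pred.
  apply/seteqP; split=> [u [[x0 _ xu] [w _ wu]]|_ ->]; last first.
    by split; exists 0 => //; rewrite (rlin0 (contraction_rlin _))//;
      exact/defect_contraction/adj_contraction.
  have [x xd xE] := range_closure x0 DAc DAs.
  have /(adj_defect_range _ Ck)[v0 _ vE] : range (defect (adj C)) u by exists w.
  have [v vd {}vE] : exists2 v, closure (range (defect C)) v & defect C v = adj C u.
    by have [v vd vE'] := range_closure v0 DCc DCs; exists v => //; rewrite vE' vE.
  have [z vz] := Zrel_total A_contr' vd.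
  (* z cancels the contribution of - x, so y is orthogonal to all rows. *)
  pose y := dfwith z k (- x).
  have yz j : (j < k)%N -> y j = z j.
    by move=> jk; rewrite /y dfwithout// gtn_eqF.
  have yk : y k = - x by rewrite /y dfwithin.
  have : y k = 0.
    apply: tot => // [j|h].
      rewrite ltnS leq_eqVlt => /predU1P[->|jk].
        rewrite yk -[- x]addr0 -scaleN1r.
        apply: closure_range_lincomb DAc.1 xd _; apply: subset_closure.
        by exists 0 => //; exact: (rlin0 (contraction_rlin DAc)).
      by rewrite yz//; exact: (row_cod (Zrel_cod vz)).
    rewrite /frip big_ord_recr/= yk ripNl /row.
    rewrite -DAs xE xu rip_sym (adjP Ck) rip_sym -vE DCs.
    rewrite -(Zrel_adj A_contr' vz h); apply/eqP; rewrite subr_eq0; apply/eqP.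
    by apply: eq_bigr => j _; rewrite yz.
  rewrite yk => /eqP; rewrite oppr_eq0 => /eqP x_0.
  by rewrite /= -xu -xE x_0 (rlin0 (contraction_rlin DAc)).
move=> x xd x0.
have x0' h : frip k x (row A h) + rip (DA (x k)) (C h) = 0.
  by rewrite DAs -(x0 h) /frip big_ord_recr.
have xk : x k = 0.
  (* Only the projection p of x on the closure of the rows has a preimage y. *)
  have [p pr hp] := fam_closure_proj (row_rlin A_contr') x.
  have [y yp] := Zrel_surj A_contr' pr.
  apply: (closure_range_null DAc DAs); first exact: xd.
  suff : (range DA `&` range (defect (adj C))) (DA (x k)) by rewrite I.
  split; first by exists (x k).
  apply/(adj_defect_range _ Ck); exists (- y) => //.
  apply: rip_inj => h; rewrite (rlinN (contraction_rlin DCc)) ripNl DCs.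
  rewrite -(Zrel_adj A_contr' yp) [RHS]rip_sym -(adjP Ck) rip_sym.
  have /eqP := hp h; rewrite fripBl subr_eq0 => /eqP <-.
  by have := x0' h; lra.
move=> i; rewrite ltnS leq_eqVlt => /predU1P[->//|ik].
apply: tot ik => [j jk|h]; first exact/xd/ltnW.
by have := x0' h; rewrite xk (rlin0 (contraction_rlin DAc)) rip0l addr0.
Qed.

End Step.

(** * The theorem *)

(** Induction on the number of factors; a single factor is always total, since
    its rows are the range of the defect operator itself. *)
Lemma row_totalP (R : realType) (H : nat -> hilbertType R)
    (A : forall i, {linear H i -> H i.+1}) (k : nat) :
  (0 < k)%N -> (forall i, (i < k)%N -> contractive (A i)) ->
  row_total A k <-> forall j, (1 <= j < k)%N ->
    range (defect (A j)) `&` range (defect (adj (chain A j))) = [set 0].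
Proof.
elim: k => // k IH _ Ac; have Ac' i : (i < k)%N -> contractive (A i).
  by move=> /ltnW; exact: Ac.
case: k => [|k] in IH Ac Ac' *.
  split=> [_ j|_ x xd x0]; first by case: j => [|[]].
  apply: fam_closure_orth x0 => e /(proj1 (closure_sqn _ _) (xd 0%N isT)).
  by move=> [_ [v _ <-] hv]; exists v => -[].
rewrite (row_totalS Ac) IH//; split=> [[I Ik] j /andP[j1]|I].
  by rewrite ltnS leq_eqVlt => /predU1P[->//|jk]; apply: I; rewrite j1.
split; last by apply: I => /=.
by move=> j /andP[j1 jk]; apply: I; rewrite j1 ltnW.
Qed.

Unset Implicit Arguments.

Theorem proposition2p6 (R : realType) (k : nat) (hk : (2 <= k)%N)
    (H : nat -> hilbertType R)
    (Hsep : forall i, (i <= k)%N -> separable (H i))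
    (A : forall i, {linear H i -> H i.+1})
    (A_contr : forall i, (i < k)%N -> contractive (A i)) :
  let regular := k_regular A k in
  let dense_sums := forall j, (1 <= j < k)%N ->
    closure [set (defect (A j) h, defect (adj (chain A j)) h) | h in [set: H j]]
      = defect_space (A j) `*` defect_space (adj (chain A j)) in
  let trivial_intersections := forall j, (1 <= j < k)%N ->
    range (defect (A j)) `&` range (defect (adj (chain A j))) = [set 0] in
  (regular <-> dense_sums) /\ (dense_sums <-> trivial_intersections).
Proof.
move=> regular dense_sums trivial_intersections.
have regularE : regular <-> trivial_intersections.
  have tot := row_totalP (ltnW hk) A_contr; split.
    by move=> /(regular_row_total A_contr)/tot.
  by move=> /tot/(row_total_regular A_contr).
suff denseE : dense_sums <-> trivial_intersections.
  by split => //; rewrite regularE denseE.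
have dense1 j : (1 <= j < k)%N ->
    closure [set (defect (A j) h, defect (adj (chain A j)) h) | h in [set: H j]]
      = defect_space (A j) `*` defect_space (adj (chain A j)) <->
    range (defect (A j)) `&` range (defect (adj (chain A j))) = [set 0].
  move=> /andP[_ jk]; have Aj := factor_contraction A_contr jk.
  have Cj := adj_contraction (chain_contraction A_contr (ltnW jk)).
  have Aj' := defect_contraction Aj; have Cj' := defect_contraction Cj.
  have Ajs := defect_symm Aj; have Cjs := defect_symm Cj.
  by rewrite -(joint_kernelP Aj' Ajs Cj' Cjs) -(dense_pairP Aj' Ajs Cj' Cjs).
by split=> h j jk; apply/(dense1 j jk)/h.
Qed.
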